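(* Let $G=(V,E)$ be a loopless hypergraph with $n=|V|$, and let $\mathcal{M}=\mathcal{M}(G;\mathfrak{I}^{q\text{-Potts}})$ be the induced Delta Potts model. Its rank function $r_{\mathcal{M}}$ is the rank function of the hypergraphical polymatroid: $$r_{\mathcal{M}}(A)=n-\kappa(G_A)=\chi_G(A)\qquad\text{for all }A\subseteq E.$$
   Context: A hypergraph $G=(V,E)$ has a finite vertex set $V$ and a finite multiset $E$ of hyperedges, each a finite multiset of elements of $V$; it is loopless if every hyperedge is a set. For $A\subseteq E$, $G_A=(V,A)$ is the spanning subhypergraph. $\kappa(H)$ is the number of connected components of $H$: two vertices $v_1,v_2$ are in the same component iff $v_1=v_2$ or there are hyperedges $e_1,\dots,e_k$ of $H$ with $v_1\in e_1$, $v_2\in e_k$ and $e_i,e_{i+1}$ sharing a vertex for all $1\le i<k$. The hypergraphical polymatroid of $G$ has rank function $\chi_G(A)=n-\kappa(G_A)$ for $A\subseteq E$. Delta Potts family $\mathfrak{I}^{q\text{-Potts}}$ ($q\ge2$ an integer): spin value set $S=[q]$ and $\Phi^k(s_1,\dots,s_k)=1$ if $s_i=s_j$ for all $i,j$, and $0$ otherwise. The induced model $\mathcal{M}(G;\mathfrak{I}^{q\text{-Potts}})$ has interaction functions $\phi^e(\boldsymbol{s})=\Phi^{|e|}((s_i)_{i\in e})$ for $\boldsymbol{s}\in S^V$, $e\in E$. Its rank function is $r_{\mathcal{M}}(A)=|V|-\log_q\#\{\boldsymbol{s}\in S^V\mid\phi^e(\boldsymbol{s})=1\ \forall e\in A\}$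 if this count is positive and $\infty$ otherwise. *)

(* Defs.v *)
From HB Require Import structures.
From mathcomp Require Import all_boot all_order all_algebra.
From mathcomp Require Import finmap multiset.
From mathcomp Require Import boolp reals constructive_ereal exp.

Set Implicit Arguments.
Unset Strict Implicit.
Unset Printing Implicit Defensive.

Import Order.TTheory GRing.Theory Num.Theory.

Local Open Scope mset_scope.
Local Open Scope ring_scope.

(* The multiset of hyperedges is given by a finite type of labels, so that
   parallel hyperedges are distinct labels with the same [ends], and
   sub-multisets A of E are sets of labels. *)
Record hypergraph := Hypergraph {
  vertex : finType;
  edge : finType;
  ends : edge -> {mset vertex}
}.

Definition loopless (G : hypergraph) : Prop :=
  forall (e : edge G) (v : vertex G), (ends e v <= 1)%N.

Definition spanning_sub (G : hypergraph) (A : {set edge G}) : hypergraph :=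
  @Hypergraph (vertex G) {e : edge G | e \in A} (fun e => ends (val e)).

Definition share_vertex (H : hypergraph) : rel (edge H) :=
  fun e f => [exists v : vertex H, (v \in ends e) && (v \in ends f)].

(* The chain e_1, ..., e_k (k >= 1) is e :: p. *)
Definition same_component (H : hypergraph) (v w : vertex H) : Prop :=
  v = w \/
  exists (e : edge H) (p : seq (edge H)),
    [/\ v \in ends e, w \in ends (last e p) & path (@share_vertex H) e p].

Definition kappa (H : hypergraph) : nat :=
  #|equivalence_partition
      (fun v w : vertex H => `[< same_component v w >]) [set: vertex H]|.

Definition chi (G : hypergraph) (A : {set edge G}) : int :=
  #|vertex G|%:Z - (kappa (spanning_sub A))%:Z.

(* Symmetry is what makes Phi^k((s_i)_{i in e}) independent of an ordering
   of e. The spin value set [q] is 'I_q. *)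
Record interaction_family (q : nat) := InteractionFamily {
  interaction : forall k : nat, k.-tuple 'I_q -> nat;
  interaction_sym : forall (k : nat) (s t : k.-tuple 'I_q),
    perm_eq s t -> interaction s = interaction t
}.

Definition potts_fun (q k : nat) (s : k.-tuple 'I_q) : nat :=
  if [forall i, forall j, tnth s i == tnth s j] then 1%N else 0%N.

Lemma potts_fun_sym (q k : nat) (s t : k.-tuple 'I_q) :
  perm_eq s t -> potts_fun s = potts_fun t.
Proof.
suff imp (u v : k.-tuple 'I_q) : perm_eq u v ->
    [forall i, forall j, tnth u i == tnth u j] ->
    [forall i, forall j, tnth v i == tnth v j].
  move=> st; rewrite /potts_fun; congr (if _ then _ else _).
  by apply/idP/idP; apply: imp; rewrite // perm_sym.
move=> uv /forallP cu; apply/forallP => i; apply/forallP => j.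
have /tnthP[i' ->] : tnth v i \in u by rewrite (perm_mem uv) mem_tnth.
have /tnthP[j' ->] : tnth v j \in u by rewrite (perm_mem uv) mem_tnth.
exact: (forallP (cu i')).
Qed.

Definition potts (q : nat) : interaction_family q :=
  InteractionFamily (@potts_fun_sym q).

Definition model (q : nat) (V E : finType) := E -> {ffun V -> 'I_q} -> nat.

Definition induced_model (q : nat) (G : hypergraph)
    (I : interaction_family q) : model q (vertex G) (edge G) :=
  fun e s => interaction I (map_tuple s (in_tuple (enum_mset (ends e)))).
Arguments induced_model {q} G I.

Definition num_satisfying (q : nat) (V E : finType) (M : model q V E)
    (A : {set E}) : nat :=
  #|[set s : {ffun V -> 'I_q} | [forall (e | e \in A), M e s == 1%N]]|.

Definition model_rank (R : realType) (q : nat) (V E : finType)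
    (M : model q V E) (A : {set E}) : \bar R :=
  if (0 < num_satisfying M A)%N
  then (#|V|%:R - ln ((num_satisfying M A)%:R : R) / ln (q%:R : R))%:E
  else +oo%E.

(* Main.v *)
Require Import Defs.
From mathcomp Require Import all_boot all_order all_algebra.
From mathcomp Require Import finmap multiset.
From mathcomp Require Import reals constructive_ereal.
From mathcomp Require Import boolp exp.

(** A spin configuration satisfies the Delta Potts constraints of the
    hyperedges in [A] exactly when it is constant on every such hyperedge.
    Being constant propagates along chains of overlapping hyperedges, so this
    means being constant on each connected component of the spanning
    subhypergraph of [A] ([num_satisfying_pottsE]).  Such a configuration is
    a free choice of one spin for each component ([card_class_functions]), so
    there are [q ^ kappa] of them.  As this number is positive and its
    logarithm in base [q] is [kappa], the rank is the number of vertices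
    minus [kappa]. *)

Import GRing.Theory Num.Theory.

Local Open Scope ring_scope.

(** The functions constant on the classes of an equivalence relation are the
    functions on the quotient, pulled back along the map that sends a point
    to its class; this pullback is injective because classes are nonempty. *)
Lemma card_class_functions (V T : finType) (r : rel V) :
  equivalence_rel r ->
  #|[set s : {ffun V -> T} | [forall v, forall w, r v w ==> (s v == s w)]]|
    = (#|T| ^ #|equivalence_partition r [set: V]|)%N.
Proof.
move=> r_equiv; set P := equivalence_partition r _.
have r_equivT : {in [set: V] & &, equivalence_rel r}.
  by move=> x y z _ _ _; apply: r_equiv.
have partP : partition P [set: V] := equivalence_partitionP r_equivT.
have [/eqP coverP trivP set0P] := and3P partP.
have in_pblock v w : (w \in pblock P v) = r v w.
  by rewrite pblock_equivalence_partition ?inE.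
have classP v : pblock P v \in P by rewrite pblock_mem // coverP inE.
pose class v : {B | B \in P} := exist _ (pblock P v) (classP v).
have blockP (B : {B | B \in P}) : exists v, v \in val B.
  by apply/set0Pn; apply: contraNneq set0P => <-; apply: valP.
have class_block (B : {B | B \in P}) v : v \in val B -> class v = B.
  by move=> vB; apply: val_inj; apply: (def_pblock trivP (valP B) vB).
pose pullback (g : {ffun {B | B \in P} -> T}) := [ffun v => g (class v)].
have pullback_inj : injective pullback.
  move=> g h /ffunP gh; apply/ffunP => B; have [v vB] := blockP B.
  by have := gh v; rewrite !ffunE (class_block B).
have -> : (#|T| ^ #|P|)%N = #|[set: {ffun {B | B \in P} -> T}]|.
  by rewrite cardsT card_ffun card_sig.
rewrite -(card_imset _ pullback_inj); apply: eq_card => s; rewrite inE.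
apply/idP/imsetP => [/forallP s_const | [g _ ->]].
  exists [ffun B => s (xchoose (blockP B))]; first by rewrite inE.
  apply/ffunP => v; rewrite !ffunE; apply/eqP.
  apply: (implyP (forallP (s_const v) _)).
  by rewrite -in_pblock (xchooseP (blockP (class v))).
apply/forallP => v; apply/forallP => w; apply/implyP; rewrite -in_pblock => vw.
by rewrite !ffunE (class_block (class v) w).
Qed.

Lemma share_vertex_sym (H : hypergraph) : symmetric (@share_vertex H).
Proof. by move=> e f; apply: eq_existsb => v; rewrite andbC. Qed.

(** Chains of hyperedges, seen as paths in the graph in which overlapping
    hyperedges are adjacent; the library theory of [connect] then gives their
    reversal and concatenation. *)
Lemma same_componentP (H : hypergraph) (v w : vertex H) :
  same_component v w <->
  v = w \/ exists e f : edge H,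
    [/\ v \in ends e, w \in ends f & connect (@share_vertex H) e f].
Proof.
split=> [] [-> | [e]]; try by left.
  move=> [p [ve wp ep]]; right; exists e, (last e p); split=> //.
  by apply/connectP; exists p.
move=> [f [ve wf /connectP[p ep f_last]]]; right; exists e, p.
by rewrite -f_last.
Qed.

Lemma same_component_equiv (H : hypergraph) :
  equivalence_rel (fun v w : vertex H => `[< same_component v w >]).
Proof.
have sym (v w : vertex H) : same_component v w -> same_component w v.
  move=> /same_componentP[-> | [e [f [ve wf ef]]]]; first by left.
  apply/same_componentP; right; exists f, e; split=> //.
  by rewrite (sym_connect_sym (@share_vertex_sym H)).
have trans (u v w : vertex H) :
    same_component u v -> same_component v w -> same_component u w.
  move=> /same_componentP[-> // | [e [f [ue vf ef]]]].
  move=> /same_componentP[<- | [e' [f' [ve' wf' ef']]]].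
    by apply/same_componentP; right; exists e, f.
  apply/same_componentP; right; exists e, f'; split=> //.
  apply: connect_trans ef (connect_trans (connect1 _) ef').
  by apply/existsP; exists v; rewrite vf ve'.
move=> u v w; split; first by apply/asboolP; left.
move=> /asboolP uv; apply: asbool_equiv_eq.
by split; apply: trans => //; apply: sym.
Qed.

Lemma potts_funP (q k : nat) (s : k.-tuple 'I_q) :
  reflect {in s &, forall a b, a = b} (potts_fun s == 1%N).
Proof.
rewrite /potts_fun; set c := [forall i, _].
have -> : ((if c then 1 else 0) == 1)%N = c by case: c.
apply: (iffP forallP) => [s_const a b /tnthP[i ->] /tnthP[j ->] | s_const i].
  exact/eqP/(forallP (s_const i)).
by apply/forallP => j; apply/eqP/s_const; apply: mem_tnth.
Qed.

Lemma induced_pottsP (q : nat) (G : hypergraph) (e : edge G)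
    (s : {ffun vertex G -> 'I_q}) :
  reflect {in ends e &, forall v w, s v = s w}
    (induced_model G (potts q) e s == 1%N).
Proof.
apply: (iffP (potts_funP _ _ _)) => [s_const v w ve we | s_const a b].
  by apply: s_const; apply: map_f.
by move=> /mapP[v ve ->] /mapP[w we ->]; apply: s_const.
Qed.

(** Two vertices of one hyperedge lie in the same component, by a chain of
    length one; conversely, consecutive hyperedges of a chain share a vertex,
    so the common spin of the first is passed on to the last. *)
Lemma satisfying_pottsP (q : nat) (G : hypergraph) (A : {set edge G})
    (s : {ffun vertex G -> 'I_q}) :
  (forall e, e \in A -> {in ends e &, forall v w, s v = s w}) <->
  (forall v w : vertex (spanning_sub A), same_component v w -> s v = s w).
Proof.
split=> [s_const v w [-> // | [e [p [+ + +]]]] | s_const e eA v w ve we].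
  elim: p e v => [|f p IHp] e v /= ve wp; first
    by move=> _; apply: (s_const _ (valP e)).
  move=> /andP[/existsP[u /andP[ue uf]] fp].
  by rewrite (s_const _ (valP e) v u ve ue); apply: IHp fp.
by apply: s_const; right; exists (exist _ e eA), [::].
Qed.

Lemma num_satisfying_pottsE (q : nat) (G : hypergraph) (A : {set edge G}) :
  num_satisfying (induced_model G (potts q)) A
    = (q ^ kappa (spanning_sub A))%N.
Proof.
rewrite -[q in RHS]card_ord -card_class_functions; last first.
  exact: same_component_equiv.
apply: eq_card => s; rewrite !inE; apply/forall_inP/forallP => [s_sat v | s_comp].
  apply/forallP => w; apply/implyP => /asboolP vw; apply/eqP.
  by move: v w vw; apply/satisfying_pottsP => e /s_sat/induced_pottsP.
move=> e eA; apply/induced_pottsP; move: e eA; apply/satisfying_pottsP.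
by move=> v w /asboolP vw; apply/eqP/(implyP (forallP (s_comp v) w)).
Qed.

Theorem proposition5p19 (R : realType) (q : nat) (q_ge2 : (2 <= q)%N)
    (G : hypergraph) (G_loopless : loopless G) (n : nat)
    (n_def : n = #|vertex G|) :
  forall A : {set edge G},
    model_rank R (induced_model G (potts q)) A
      = (n%:R - (kappa (spanning_sub A))%:R)%:E
    /\ (n%:R - (kappa (spanning_sub A))%:R)%:E = ((chi A)%:~R)%:E :> \bar R.
Proof.
move=> A; split; last by rewrite /chi -n_def intrB !pmulrn.
have q_gt0 : (0 < q)%N by apply: ltnW.
have ln_q_neq0 : ln (q%:R : R) != 0.
  by apply: lt0r_neq0; rewrite ln_gt0 // ltr1n.
rewrite /model_rank num_satisfying_pottsE expn_gt0 q_gt0 /= -n_def.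
by rewrite natrX lnXn ?ltr0n // -[ln _ *+ _]mulr_natl mulfK.
Qed.
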